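(* Let $M=(A,(\sim_r)_{r\in G},V)$ be a static network model, let $I$ be a nonempty subset of $\Omega$, and let $\varepsilon,\eta\in G$ with $\varepsilon<\eta$. Then $M\models B_I^{\varepsilon,\eta}$ if and only if $F_I^M$ is an $(\varepsilon,\eta)$-bubble in $M$.
   Context: Fix a positive integer $m$ and $G=\{0,\frac1m,\frac2m,\ldots,1\}$; for $r,s\in G$ let $r\oplus s=\min\{1,r+s\}$. Let $A$ be a finite nonempty set of agents, $P$ a nonempty set of propositional atoms, and $\Omega$ a finite set of nominals with $P\cap\Omega=\varnothing$ and $|\Omega|=|A|$. Static network model: a tuple $M=(A,(\sim_r)_{r\in G},V)$ where $V:P\cup\Omega\to\wp(A)$ is such that each $V(i)$, $i\in\Omega$, is a singleton and the map sending $i$ to the unique member of $V(i)$ is a bijection $\Omega\to A$; and each $\sim_r\subseteq A\times A$, with, for all $a,b,c\in A$, $r,s\in G$: $a\sim_r a$; $a\sim_r b\Leftrightarrow b\sim_r a$; $a\sim_1 b$; $a\sim_r b\Rightarrow a\sim_s b$ if $r\le s$; $a\sim_r b$ and $b\sim_s c$ imply $a\sim_{r\oplus s}c$. Put $d_M(a,b)=\min\{r\in G:a\sim_r b\}$. Language: $\varphi::=p\mid i\mid\neg\varphi\mid(\varphi\land\psi)\mid\langle r\rangle\varphi\mid @_i\varphi$ with $p\in P$, $i\in\Omega$, $r\in G$; $[r]\varphi:=\neg\langle r\rangle\neg\varphi$. Semantics at $a\in A$: $M,a\models p$ iff $a\in V(p)$; $M,a\models i$ iff $a\in V(i)$; Boolean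 clauses as usual; $M,a\models\langle r\rangle\varphi$ iff $M,b\models\varphi$ for some $b\in A$ with $a\sim_r b$; $M,a\models @_i\varphi$ iff $M,b\models\varphi$ where $V(i)=\{b\}$. $M\models\chi$ means $M,a\models\chi$ for every $a\in A$. For nonempty $I\subseteq\Omega$: $F_I^M:=\bigcup_{i\in I}V(i)$ and $f_I:=\bigvee_{i\in I}i$. For $\varepsilon<\eta$ in $G$, $F_I^M$ is an $(\varepsilon,\eta)$-bubble when $d_M(a,b)\le\varepsilon$ for all $a,b\in F_I^M$ and $d_M(a,c)>\eta$ for all $a\in F_I^M$, $c\in A\setminus F_I^M$. The formula $B_I^{\varepsilon,\eta}$ is $$B_I^{\varepsilon,\eta}:=\bigwedge_{i\in I}@_i\Bigl(\bigwedge_{j\in I}\langle\varepsilon\rangle j\ \land\ [\eta]f_I\Bigr).$$ *)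

(* Defs.v *)
From HB Require Import structures.
From mathcomp Require Import all_boot all_order all_algebra.

Set Implicit Arguments.
Unset Strict Implicit.
Unset Printing Implicit Defensive.

Import Order.TTheory GRing.Theory Num.Theory.

Local Open Scope ring_scope.

Definition grid_seq (m : nat) : seq rat :=
  [seq k%:R / m%:R | k <- iota 0 m.+1].

Definition grid (m : nat) : predArgType := seq_sub (grid_seq m).

HB.instance Definition _ (m : nat) := SubFinite.on (grid m).

Coercion grid_val (m : nat) (r : grid m) : rat := val r.

Lemma mem_grid_seq (m k : nat) : (k <= m)%N -> k%:R / m%:R \in grid_seq m.
Proof. by move=> le_km; apply/mapP; exists k => //; rewrite mem_iota. Qed.

Lemma grid_one_subproof (m : nat) : (0 < m)%N -> 1 \in grid_seq m.
Proof.
move=> m_gt0; rewrite -(@divff _ (m%:R : rat)) ?mem_grid_seq //.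
by rewrite pnatr_eq0 -lt0n.
Qed.

Lemma grid_oplus_subproof (m : nat) (m_gt0 : (0 < m)%N) (r s : grid m) :
  Num.min 1 ((r : rat) + (s : rat)) \in grid_seq m.
Proof.
rewrite minEle; case: ifP => [_|/negbT]; first exact: grid_one_subproof.
case/mapP: (valP r) => k _ Er; case/mapP: (valP s) => l _ Es.
rewrite /grid_val Er Es -mulrDl -natrD -ltNge => lt_1.
apply: mem_grid_seq; move: lt_1.
by rewrite ltr_pdivrMr ?ltr0n // mul1r ltr_nat => /ltnW.
Qed.

(* A zero [m] would give the degenerate grid {0}, which does not contain 1;
   hence the positivity argument here and below. *)
Definition grid_one (m : nat) (m_gt0 : (0 < m)%N) : grid m :=
  SeqSub (grid_one_subproof m_gt0).

Definition oplus (m : nat) (m_gt0 : (0 < m)%N) (r s : grid m) : grid m :=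
  SeqSub (grid_oplus_subproof m_gt0 r s).

(* Atoms and nominals are the two summands of [P + Omega], which makes them
   disjoint. *)
Record static_model (m : nat) (m_gt0 : (0 < m)%N) (P : Type)
    (Omega A : finType) := StaticModel {
  sim : grid m -> rel A;
  val_of : P + Omega -> {set A};
  val_nominal : exists2 f : Omega -> A,
    bijective f & forall i, val_of (inr i) = [set f i];
  sim_refl : forall r a, sim r a a;
  sim_sym : forall r a b, sim r a b <-> sim r b a;
  sim_one : forall a b, sim (grid_one m_gt0) a b;
  sim_mono : forall (r s : grid m) a b,
    (r : rat) <= (s : rat) -> sim r a b -> sim s a b;
  sim_oplus : forall (r s : grid m) a b c,
    sim r a b -> sim s b c -> sim (oplus m_gt0 r s) a c
}.

Definition dist (m : nat) (m_gt0 : (0 < m)%N) (P : Type) (Omega A : finType)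
    (M : static_model m_gt0 P Omega A) (a b : A) : grid m :=
  [arg min_(r < grid_one m_gt0 | sim M r a b) grid_val r]%O.

Inductive form (m : nat) (P : Type) (Omega : finType) : Type :=
  | Atom of P
  | Nom of Omega
  | Neg of form m P Omega
  | And of form m P Omega & form m P Omega
  | Dia of grid m & form m P Omega
  | At of Omega & form m P Omega.

Arguments Atom {m P Omega} p.
Arguments Nom {m P Omega} i.

Definition Or (m : nat) (P : Type) (Omega : finType)
    (phi psi : form m P Omega) : form m P Omega :=
  Neg (And (Neg phi) (Neg psi)).

Definition Box (m : nat) (P : Type) (Omega : finType) (r : grid m)
    (phi : form m P Omega) : form m P Omega :=
  Neg (Dia r (Neg phi)).

Fixpoint sat (m : nat) (m_gt0 : (0 < m)%N) (P : Type) (Omega A : finType)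
    (M : static_model m_gt0 P Omega A) (a : A) (phi : form m P Omega) : bool :=
  match phi with
  | Atom p => a \in val_of M (inl p)
  | Nom i => a \in val_of M (inr i)
  | Neg psi => ~~ sat M a psi
  | And psi chi => sat M a psi && sat M a chi
  | Dia r psi => [exists b, sim M r a b && sat M b psi]
  | At i psi => [exists b, (val_of M (inr i) == [set b]) && sat M b psi]
  end.

Definition valid_in (m : nat) (m_gt0 : (0 < m)%N) (P : Type)
    (Omega A : finType) (M : static_model m_gt0 P Omega A)
    (phi : form m P Omega) : Prop :=
  forall a : A, sat M a phi.

(* The language has no constant for truth or falsity, so finite conjunctions
   and disjunctions are built over a nonempty index set only: an arbitrary
   member of [I] is the innermost operand and the other members are folded
   around it. *)
Definition big_form (m : nat) (P : Type) (Omega : finType)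
    (op : form m P Omega -> form m P Omega -> form m P Omega)
    (I : {set Omega}) (I_neq0 : I != set0) (F : Omega -> form m P Omega) :
    form m P Omega :=
  let i0 := xchoose (elimT (set0Pn I) I_neq0) in
  foldr (fun i phi => op (F i) phi) (F i0) (enum (I :\ i0)).

Definition big_and (m : nat) (P : Type) (Omega : finType) :=
  big_form (@And m P Omega).

Definition big_or (m : nat) (P : Type) (Omega : finType) :=
  big_form (@Or m P Omega).

Definition nom_form (m : nat) (P : Type) (Omega : finType)
    (I : {set Omega}) (I_neq0 : I != set0) : form m P Omega :=
  big_or I_neq0 (fun i => Nom i).

Definition bubble_form (m : nat) (P : Type) (Omega : finType)
    (I : {set Omega}) (I_neq0 : I != set0) (eps eta : grid m) :
    form m P Omega :=
  big_and I_neq0 (fun i =>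
    At i (And (big_and I_neq0 (fun j => Dia eps (Nom j)))
              (Box eta (nom_form m P I_neq0)))).

Definition nom_set (m : nat) (m_gt0 : (0 < m)%N) (P : Type)
    (Omega A : finType) (M : static_model m_gt0 P Omega A)
    (I : {set Omega}) : {set A} :=
  \bigcup_(i in I) val_of M (inr i).

Definition bubble (m : nat) (m_gt0 : (0 < m)%N) (P : Type)
    (Omega A : finType) (M : static_model m_gt0 P Omega A)
    (F : {set A}) (eps eta : grid m) : Prop :=
  (forall a b, a \in F -> b \in F ->
     (dist M a b : rat) <= (eps : rat)) /\
  (forall a c, a \in F -> c \notin F ->
     (eta : rat) < (dist M a c : rat)).

(* Main.v *)
(** A nominal [i] in [I] names an agent [f i], and [F_I] is the image of [I]
under [f].  Since the relations [sim r] grow with [r], [sim r a b] amounts to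
[d(a, b) <= r].  Hence the conjuncts [<eps> j] at [f i] say that [f j] is at
distance at most [eps] from [f i], and [[eta] f_I] at [f i] says
contrapositively that agents outside [F_I] are farther than [eta]. *)
Require Import Defs.
From mathcomp Require Import all_boot all_order all_algebra.

Set Implicit Arguments.
Unset Strict Implicit.
Unset Printing Implicit Defensive.

Import Order.TTheory.

Local Open Scope ring_scope.

Section StaticModel.

Variables (m : nat) (m_gt0 : (0 < m)%N) (P : Type) (Omega A : finType).
Variable M : static_model m_gt0 P Omega A.

Implicit Types (a b : A) (r : grid m) (phi psi : Defs.form m P Omega).
Implicit Types (I : {set Omega}) (F : Omega -> Defs.form m P Omega).

(** By [sim_one] the minimum ranges over a nonempty set, so it is attained; [sim_mono] lifts the
    attained radius to [r], and minimality gives the converse. *)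
Lemma dist_le a b r : ((dist M a b : rat) <= (r : rat)) = sim M r a b.
Proof.
rewrite /dist; case: arg_minP => [|s sim_s min_s]; first exact: sim_one.
by apply/idP/idP => [le_sr|/min_s//]; apply: sim_mono le_sr sim_s.
Qed.

Lemma sat_And a phi psi : sat M a (And phi psi) = sat M a phi && sat M a psi.
Proof. by []. Qed.

Lemma sat_Or a phi psi : sat M a (Or phi psi) = sat M a phi || sat M a psi.
Proof. by rewrite /= negb_and !negbK. Qed.

Lemma sat_Box a r phi :
  sat M a (Box r phi) = [forall b, sim M r a b ==> sat M b phi].
Proof.
by rewrite /= negb_exists; apply: eq_forallb => b; rewrite negb_and negbK implybE.
Qed.

(** The arbitrary choice of [i0] is harmless: [i0] followed by [enum (I :\ i0)] lists exactly the
    members of [I]. *)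
Lemma sat_big_and a I (I_neq0 : I != set0) F :
  sat M a (big_and I_neq0 F) = [forall i in I, sat M a (F i)].
Proof.
rewrite /big_and /big_form.
set i0 := xchoose _; have Ii0 : i0 \in I by apply: xchooseP.
(* Stated for any [s], since [enum (I :\ i0)] is unsuited to induction; [andbCA] brings the
   innermost operand [F i0] to the front. *)
have -> (s : seq Omega) : sat M a (foldr (fun i => And (F i)) (F i0) s) =
    all (fun i => sat M a (F i)) (i0 :: s).
  by elim: s => [|i s IHs] /=; rewrite ?andbT // IHs /= andbCA.
apply/allP/forall_inP => sat_F i; last first.
  by rewrite inE mem_enum !inE => /predU1P[->|/andP[_]]; apply: sat_F.
by move=> Ii; apply: sat_F; rewrite inE mem_enum !inE Ii andbT orbN.
Qed.

Lemma sat_big_or a I (I_neq0 : I != set0) F :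
  sat M a (big_or I_neq0 F) = [exists i in I, sat M a (F i)].
Proof.
rewrite /big_or /big_form.
set i0 := xchoose _; have Ii0 : i0 \in I by apply: xchooseP.
have -> (s : seq Omega) : sat M a (foldr (fun i => Or (F i)) (F i0) s) =
    has (fun i => sat M a (F i)) (i0 :: s).
  (* Only the fold is simplified at first: a full [/=] would unfold [Or] into negations before
     [sat_Or] could apply. *)
  by elim: s => [|i s IHs]; rewrite ?[foldr _ _ _]/= ?sat_Or ?IHs /= ?orbF // orbCA.
apply/hasP/exists_inP => [] [i]; last first.
  by move=> Ii; exists i; rewrite // inE mem_enum !inE Ii andbT orbN.
rewrite inE mem_enum !inE => Ii sat_i; exists i => //.
by case/predU1P: Ii => [->|/andP[]].
Qed.

Lemma sat_nom_form a I (I_neq0 : I != set0) :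
  sat M a (nom_form m P I_neq0) = (a \in nom_set M I).
Proof. by rewrite sat_big_or; apply/exists_inP/bigcupP. Qed.

Section Naming.

Variable f : Omega -> A.
Hypothesis val_f : forall i, val_of M (inr i) = [set f i].

Lemma sat_Dia_Nom a r i : sat M a (Dia r (Nom i)) = sim M r a (f i).
Proof.
apply/existsP/idP => [[b]|sim_ai] /=; last first.
  by exists (f i); rewrite sim_ai /= val_f set11.
by rewrite val_f in_set1 => /andP[sim_ab /eqP <-].
Qed.

Lemma sat_At a i phi : sat M a (At i phi) = sat M (f i) phi.
Proof.
apply/existsP/idP => [[b]|sat_i]; last by exists (f i); rewrite val_f eqxx.
by rewrite val_f => /andP[/eqP/set1_inj->].
Qed.

Lemma mem_nom_set a I : reflect (exists2 i, i \in I & a = f i) (a \in nom_set M I).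
Proof.
apply: (iffP bigcupP) => [] [i Ii ai]; exists i => //; last by rewrite val_f ai set11.
by move: ai; rewrite val_f => /set1P.
Qed.

End Naming.

End StaticModel.

Theorem proposition2p2 (m : nat) (m_gt0 : (0 < m)%N)
    (A : finType) (A_neq0 : (0 < #|A|)%N)
    (P : Type) (P_neq0 : inhabited P)
    (Omega : finType) (card_Omega : #|Omega| = #|A|)
    (M : static_model m_gt0 P Omega A)
    (I : {set Omega}) (I_neq0 : I != set0)
    (eps eta : grid m) (lt_eps_eta : (eps : rat) < (eta : rat)) :
  valid_in M (bubble_form P I_neq0 eps eta) <->
  bubble M (nom_set M I) eps eta.
Proof.
have [f _ val_f] := val_nominal M.
have fP := mem_nom_set val_f.
(* The condition does not mention [a]: each conjunct starts with [At], which moves evaluation to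
   [f i]. *)
have sat_bubble a : reflect
    (forall i, i \in I -> (forall j, j \in I -> sim M eps (f i) (f j)) /\
       (forall b, sim M eta (f i) b -> b \in nom_set M I))
    (sat M a (bubble_form P I_neq0 eps eta)).
  rewrite sat_big_and; apply: (iffP forall_inP) => sat_I i /sat_I;
    rewrite (sat_At val_f) sat_And sat_big_and sat_Box.
    case/andP=> /forall_inP near /forallP far; split=> [j /near|b sim_b].
      by rewrite (sat_Dia_Nom val_f).
    by have /implyP/(_ sim_b) := far b; rewrite sat_nom_form.
  case=> near far; apply/andP; split.
    by apply/forall_inP => j /near; rewrite (sat_Dia_Nom val_f).
  by apply/forallP => b; apply/implyP => /far; rewrite sat_nom_form.
split=> [valid_B|[near far] a].
  split=> [a b /fP[i Ii ->] /fP[j Ij ->]|a c /fP[i Ii ->]].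
    (* Validity needs some agent to be evaluated at; [f i] is at hand. *)
    by rewrite dist_le; have [/(_ j Ij)] := sat_bubble _ (valid_B (f i)) i Ii.
  (* Contrapositively, an agent [c] within [eta] of [f i] lies in [nom_set M I], which is the box
     conjunct. *)
  apply: contraNT; rewrite -leNgt dist_le.
  by have [_] := sat_bubble _ (valid_B (f i)) i Ii; apply.
apply/sat_bubble => i Ii; have Fi : f i \in nom_set M I by apply/fP; exists i.
split=> [j Ij|b]; first by rewrite -dist_le; apply: near => //; apply/fP; exists j.
by rewrite -dist_le; apply: contraTT => /(far _ _ Fi); rewrite ltNge.
Qed.
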